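(* Let $\mathcal{A}\in Sp(2d,\mathbb{R})$ have block decomposition $\mathcal{A}=(A_{ij})_{i,j=1,\dots,4}$ with $A_{ij}$ real $d\times d$ matrices. Then the representation $W_{\mathcal{A}}$ is covariant, namely $$W_{\mathcal{A}}(\pi(z)f)=T_zW_{\mathcal{A}}f,\qquad f\in\mathcal{S}(\mathbb{R}^d),\ z\in\mathbb{R}^{2d},$$ if and only if $\mathcal{A}$ is of the form $$\mathcal{A}=\begin{pmatrix}A_{11}&I_{d\times d}-A_{11}&A_{13}&A_{13}\\ A_{21}&-A_{21}&I_{d\times d}-A_{11}^T&-A_{11}^T\\ A_{31}&-A_{31}&A_{33}&A_{33}\\ A_{41}&-A_{41}&A_{43}&A_{43}\end{pmatrix}.$$ The result does not depend on the choice of the phase factor in the definition of $\mu(\mathcal{A})$ and $W_{\mathcal{A}}$.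
   Context: $Sp(n,\mathbb{R})=\{\mathcal{A}\in GL(2n,\mathbb{R}):\mathcal{A}^TJ\mathcal{A}=J\}$, $J=\begin{pmatrix}0&I_{n\times n}\\-I_{n\times n}&0\end{pmatrix}$; so $\mathcal{A}\in Sp(2d,\mathbb{R})$ is a $4d\times4d$ matrix. Time-frequency shifts on $\mathbb{R}^n$: $\pi(x,\xi)F(t)=M_\xi T_xF(t)=e^{2\pi i\xi\cdot t}F(t-x)$; $T_z$ denotes translation by $z$, $T_zG(w)=G(w-z)$. Metaplectic operator: for $\mathcal{A}\in Sp(n,\mathbb{R})$, $\mu(\mathcal{A})$ is the unitary operator on $L^2(\mathbb{R}^n)$, determined up to a multiplicative phase factor, such that for every $w\in\mathbb{R}^{2n}$ one has $\pi(\mathcal{A}w)=c\,\mu(\mathcal{A})\pi(w)\mu(\mathcal{A})^{-1}$ for some $c\in\mathbb{C}$, $|c|=1$ (depending on $\mathcal{A}$ and $w$). For instance $\mu(J)$ is the Fourier transform $\hat f(\xi)=\int f(t)e^{-2\pi it\cdot\xi}dt$. $\mathcal{A}$-Wigner representation: for $\mathcal{A}\in Sp(2d,\mathbb{R})$ and $f,g\in L^2(\mathbb{R}^d)$, $W_{\mathcal{A}}(f,g)=\mu(\mathcal{A})(f\otimes\bar g)\in L^2(\mathbb{R}^{2d})$, and $W_{\mathcal{A}}f=W_{\mathcal{A}}(f,f)$.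
   Formalization: The phase c in π(Aw)=c μ(A)π(w)μ(A)^{-1} is fixed as exp(iπ(x'·ξ'−x·ξ)), with w=(x,ξ), Aw=(x',ξ'); with an arbitrary unimodular c depending on w, μ(A) is not determined up to a phase factor and the ''if'' direction fails. *)

(* Defs.v *)
From HB Require Import structures.
From mathcomp Require Import all_boot all_order all_algebra.
From mathcomp Require Import all_classical all_reals all_analysis.
From mathcomp Require Import complex.

Set Implicit Arguments.
Unset Strict Implicit.
Unset Printing Implicit Defensive.

Import Order.TTheory GRing.Theory Num.Theory.
Import numFieldNormedType.Exports.

Local Open Scope classical_set_scope.
Local Open Scope ring_scope.

(* The product sigma-algebra on matrices, generated by the coordinates; on
   'cV[R]_n it is the Borel sigma-algebra of R^n. *)
Definition measure_matrix_display : measure_display -> measure_display.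
Proof. exact. Qed.

Definition matrix_cylinder d (T : measurableType d) (m n : nat) :
    set (set 'M[T]_(m, n)) :=
  [set C | exists i j (B : set T),
     measurable B /\ C = (fun M : 'M[T]_(m, n) => M i j) @^-1` B].

HB.instance Definition _ d (T : measurableType d) (m n : nat) :=
  @isMeasurable.Build (measure_matrix_display d) 'M[T]_(m, n)
    <<s @matrix_cylinder d T m n >>
    (@sigma_algebra0 _ _ _) (@sigma_algebraC _ _) (@sigma_algebra_bigcup _ _ _).

Section lebesgue_step.
Variables (R : realType) (n : nat).

Definition cV_cons (p : measurableTypeR R * 'cV[R]_n) : 'cV[R]_n.+1 :=
  col_mx (p.1 : R)%:M p.2.

Definition cV_uncons (v : 'cV[R]_n.+1) : measurableTypeR R * 'cV[R]_n :=
  (v 0 0, dsubmx (v : 'cV[R]_(1 + n))).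

Lemma cV_consK : cancel cV_cons cV_uncons.
Proof.
move=> [t v]; rewrite /cV_uncons /cV_cons col_mxKd; congr (_, _).
have /matrixP/(_ 0 0) := col_mxKu ((t : R)%:M : 'M[R]_1) v.
rewrite [usubmx _ _ _]mxE [X in _ = X]mxE eqxx mulr1n; apply: etrans.
by congr (col_mx _ _ _ _); apply/val_inj.
Qed.

Lemma cV_unconsK : cancel cV_uncons cV_cons.
Proof.
move=> v; apply: etrans (@vsubmxK _ 1 n 1 v).
congr (col_mx _ _); apply/matrixP => i j; rewrite !ord1 !mxE eqxx mulr1n.
by congr (v _ _); apply/val_inj.
Qed.

Lemma measurable_cV_coord m (i : 'I_m) :
  measurable_fun setT (fun v : 'cV[R]_m => v i 0).
Proof.
by move=> _ D mD; rewrite setTI; apply: sub_sigma_algebra; exists i, 0, D.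
Qed.

Lemma measurable_cV_cons : measurable_fun setT cV_cons.
Proof.
apply: (@measurability _ _ _ _ setT cV_cons (@matrix_cylinder _ R n.+1 1)) => //.
move=> _ [C [i [j [B [mB ->]]]] <-].
rewrite setTI -comp_preimage /comp -[X in measurable X]setTI (ord1 j).
case: (unliftP ord0 i) => [k ->|->].
- rewrite (_ : (fun x => _) = (fun M : 'cV[R]_n => M k 0) \o snd).
    by apply: (measurableT_comp (measurable_cV_coord k) measurable_snd).
  apply/funext => x /=; have /(congr1 snd)/matrixP/(_ k 0) := cV_consK x.
  by rewrite [LHS]mxE => <-; congr (cV_cons x _ _); apply/val_inj.
- rewrite (_ : (fun x => _) = fst); first exact: measurable_fst.
  by apply/funext => x /=; have /(congr1 fst) := cV_consK x.
Qed.

Lemma measurable_cV_uncons : measurable_fun setT cV_uncons.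
Proof.
apply: measurable_fun_pair; first exact: (measurable_cV_coord 0).
apply: (@measurability _ _ _ _ setT _ (@matrix_cylinder _ R n 1)) => //.
move=> _ [C [i [j [B [mB ->]]]] <-].
rewrite setTI -comp_preimage /comp -[X in measurable X]setTI (ord1 j).
rewrite (_ : (fun x => _) =
             (fun v : 'cV[R]_n.+1 => v (rshift 1 i : 'I_(1 + n)) 0)).
  exact: measurable_cV_coord.
by apply/funext => x; rewrite mxE.
Qed.

HB.instance Definition _ := @isMeasurableFun.Build _ _ _ _ cV_cons
  measurable_cV_cons.

Variable mu : {sigma_finite_measure set 'cV[R]_n -> \bar R}.

Definition lebesgue_step : set 'cV[R]_n.+1 -> \bar R :=
  pushforward (lebesgue_measure \x mu)%E cV_cons.

Let lebesgue_step0 : lebesgue_step set0 = 0%E.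
Proof. exact: measure0. Qed.

Let lebesgue_step_ge0 A : (0 <= lebesgue_step A)%E.
Proof. exact: measure_ge0. Qed.

Let lebesgue_step_sigma_additive : semi_sigma_additive lebesgue_step.
Proof. exact: measure_semi_sigma_additive. Qed.

HB.instance Definition _ := isMeasure.Build _ _ _ lebesgue_step
  lebesgue_step0 lebesgue_step_ge0 lebesgue_step_sigma_additive.

Let lebesgue_step_sigma_finite : sigma_finite setT lebesgue_step.
Proof.
have /sigma_finiteP[F [TF ndF Foo]] :=
  sigma_finiteT (lebesgue_measure :
    {sigma_finite_measure set (measurableTypeR R) -> \bar R}).
have /sigma_finiteP[G [TG ndG Goo]] := sigma_finiteT mu.
exists (fun k => cV_uncons @^-1` (F k `*` G k)).
  apply/seteqP; split=> // v _.
  have [i _ Fv] : (\bigcup_i F i) (cV_uncons v).1 by rewrite -TF.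
  have [j _ Gv] : (\bigcup_j G j) (cV_uncons v).2 by rewrite -TG.
  exists (maxn i j) => //; split.
    by move: Fv; exact/subsetPset/ndF/leq_maxl.
  by move: Gv; exact/subsetPset/ndG/leq_maxr.
move=> k; have [mF Fk] := Foo k; have [mG Gk] := Goo k; split.
  rewrite -[X in measurable X]setTI; apply: measurable_cV_uncons => //.
  exact: measurableX.
rewrite /lebesgue_step /pushforward -comp_preimage.
rewrite (_ : _ \o _ = id); last by apply/funext => x /=; rewrite cV_consK.
by rewrite preimage_id product_measure1E// lte_mul_pinfty// ge0_fin_numE.
Qed.

HB.instance Definition _ := @Measure_isSigmaFinite.Build _ _ _ lebesgue_step
  lebesgue_step_sigma_finite.

End lebesgue_step.

(* Lebesgue measure on R^n: the n-fold product of Lebesgue measure on R,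
   transported to columns through (t, v) |-> col_mx t v. *)
Fixpoint lebesgue_cV (R : realType) (n : nat) :
    {sigma_finite_measure set 'cV[R]_n -> \bar R} :=
  match n with
  | 0 => dirac (0 : 'cV[R]_0)
  | m.+1 => lebesgue_step (lebesgue_cV R m)
  end.

Local Open Scope complex_scope.

(* Elements of L^2(R^n) are handled through representatives: a class is given
   by a function in [L2], and equality in L^2 is [=ae]. *)
Definition cfun (R : realType) (n : nat) := 'cV[R]_n -> R[i].

Definition eq_ae (R : realType) (n : nat) (F G : cfun R n) : Prop :=
  {ae lebesgue_cV R n, forall t, F t = G t}.

Definition L2 (R : realType) (n : nat) (F : cfun R n) : Prop :=
  [/\ measurable_fun setT (fun t => complex.Re (F t)),
      measurable_fun setT (fun t => complex.Im (F t)) &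
      (\int[lebesgue_cV R n]_t
         ((complex.Re (F t)) ^+ 2 + (complex.Im (F t)) ^+ 2)%:E < +oo)%E].

Definition L2_inner (R : realType) (n : nat) (F G : cfun R n) : R[i] :=
  (\int[lebesgue_cV R n]_t complex.Re (F t * conjc (G t))) +i*
  (\int[lebesgue_cV R n]_t complex.Im (F t * conjc (G t))).

Definition unitary_L2 (R : realType) (n : nat)
    (U : cfun R n -> cfun R n) : Prop :=
  [/\ forall F, L2 F -> L2 (U F),
      forall F G, L2 F -> L2 G -> eq_ae F G -> eq_ae (U F) (U G),
      forall (a : R[i]) F G, L2 F -> L2 G ->
        eq_ae (U (fun t => a * F t + G t)) (fun t => a * U F t + U G t),
      forall F G, L2 F -> L2 G -> L2_inner (U F) (U G) = L2_inner F G &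
      forall G, L2 G -> exists2 F, L2 F & eq_ae (U F) G].

Definition expi (R : realType) (x : R) : R[i] := cos x +i* sin x.

Definition dotc (R : realType) (n : nat) (x y : 'cV[R]_n) : R :=
  \sum_(i < n) x i 0 * y i 0.

Definition translate (R : realType) (n : nat) (z : 'cV[R]_n)
    (G : cfun R n) : cfun R n :=
  fun w => G (w - z).

Definition modulate (R : realType) (n : nat) (xi : 'cV[R]_n)
    (G : cfun R n) : cfun R n :=
  fun t => expi (2 * pi * dotc xi t) * G t.

(* A phase-space point (x, xi) of R^n x R^n is the stacked column
   [col_mx x xi]. *)
Definition tfshift (R : realType) (n : nat) (z : 'cV[R]_(n + n)) :
    cfun R n -> cfun R n :=
  fun F => modulate (dsubmx z) (translate (usubmx z) F).

Definition symplectic_J (R : realType) (n : nat) : 'M[R]_(n + n) :=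
  block_mx 0 1%:M (- 1%:M) 0.

Definition Sp (R : realType) (n : nat) : set 'M[R]_(n + n) :=
  [set A | A \in unitmx /\
           A^T *m symplectic_J R n *m A = symplectic_J R n].

(* The phase c = c(A, w) in pi(A w) = c mu(A) pi(w) mu(A)^-1.  Writing
   rho(x, xi) = e^{- i pi x.xi} pi(x, xi) for the Schroedinger representation
   with central variable 0, it is the phase for which
   rho(A w) = mu(A) rho(w) mu(A)^-1.  Were c allowed to be any unimodular
   function of w, every mu(A) o pi(u) would qualify besides mu(A), and mu(A)
   would not be determined up to a constant phase factor. *)
Definition metaplectic_phase (R : realType) (n : nat)
    (A : 'M[R]_(n + n)) (w : 'cV[R]_(n + n)) : R[i] :=
  expi (pi * (dotc (usubmx (A *m w)) (dsubmx (A *m w))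
              - dotc (usubmx w) (dsubmx w))).

(* [U] is one of the operators mu(A); the others differ from it by a constant
   phase factor.  The intertwining relation is composed with mu(A) on the
   right. *)
Definition metaplectic (R : realType) (n : nat) (A : 'M[R]_(n + n))
    (U : cfun R n -> cfun R n) : Prop :=
  unitary_L2 U /\
  forall (w : 'cV[R]_(n + n)) (F : cfun R n), L2 F ->
    eq_ae (tfshift (A *m w) (U F))
          (fun t => metaplectic_phase A w * U (tfshift w F) t).

Definition tensor_conj (R : realType) (d : nat) (f g : cfun R d) :
    cfun R (d + d) :=
  fun t => f (usubmx t) * conjc (g (dsubmx t)).

(* The A-Wigner representation W_A(f, g), where [muA] is mu(A). *)
Definition Wigner_rep (R : realType) (d : nat)
    (muA : cfun R (d + d) -> cfun R (d + d)) (f g : cfun R d) :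
    cfun R (d + d) :=
  muA (tensor_conj f g).

Definition partials (R : realType) (d : nat) (s : seq 'I_d)
    (g : 'cV[R]_d -> R) : 'cV[R]_d -> R :=
  foldr (fun i h x => 'D_(delta_mx i 0) h x) g s.

(* Ranging over all lists [s], the first two clauses say that g is C^oo; each
   multi-index derivative is [partials s g] for some [s]. *)
Definition schwartz_real (R : realType) (d : nat) (g : 'cV[R]_d -> R) : Prop :=
  forall s : seq 'I_d,
    [/\ continuous (partials s g),
        forall i x, derivable (partials s g) x (delta_mx i 0) &
        forall a : 'I_d -> nat, exists C : R, forall x : 'cV[R]_d,
          `|(\prod_(i < d) x i 0 ^+ a i) * partials s g x| <= C].

Definition schwartz (R : realType) (d : nat) (f : cfun R d) : Prop :=
  schwartz_real (fun x => complex.Re (f x)) /\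
  schwartz_real (fun x => complex.Im (f x)).

Definition covariant (R : realType) (d : nat)
    (muA : cfun R (d + d) -> cfun R (d + d)) : Prop :=
  forall (f : cfun R d) (z : 'cV[R]_(d + d)), schwartz f ->
    eq_ae (Wigner_rep muA (tfshift z f) (tfshift z f))
          (translate z (Wigner_rep muA f f)).

Definition block44 (R : realType) (d : nat)
    (A11 A12 A13 A14 A21 A22 A23 A24
     A31 A32 A33 A34 A41 A42 A43 A44 : 'M[R]_d) :
    'M[R]_((d + d) + (d + d)) :=
  block_mx (block_mx A11 A12 A21 A22) (block_mx A13 A14 A23 A24)
           (block_mx A31 A32 A41 A42) (block_mx A33 A34 A43 A44).

(* Main.v *)
Require Import Defs.
From mathcomp Require Import all_boot all_order all_algebra.
From mathcomp Require Import all_classical all_reals all_analysis.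
From mathcomp Require Import measurable_realfun complex ring lra.

Set Implicit Arguments.
Unset Strict Implicit.
Unset Printing Implicit Defensive.

Import Order.TTheory GRing.Theory Num.Theory.
Import numFieldNormedType.Exports.
Local Open Scope classical_set_scope.
Local Open Scope complex_scope.
Local Open Scope ring_scope.

(** Write F for the tensor product of f with its conjugate. Shifting f by
    z = (x, xi) shifts F by the doubled point K z = (x, x, xi, - xi)
    ([tensor_conj_tfshift]), so covariance says that muA (pi(K z) F) is the
    translate of muA F by z, that is, its shift by (z, 0). On the other hand
    muA intertwines the shift by w with the shift by A w.

    If A K z = (z, 0) for all z, the two statements coincide, because the phases
    attached to K z and to (z, 0) are both trivial. Conversely put
    v = A^-1 (z, 0). Covariance and intertwining show that muA sends pi(K z) F
    and a unimodular multiple of pi(v) F to the same class, so these functions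
    agree almost everywhere by unitarity ([unitary_L2_phase]). For a Gaussian f
    the function F is again a Gaussian and both sides are continuous, so they agree
    everywhere ([eq_ae_ccontinuous]), and a Gaussian and its shift up to a phase
    determine the shift ([tfshift_gauss_inj]): K z = v, i.e. A K z = (z, 0).
    This is [covariant_doublingP].

    It remains to compare A K = (1, 0) with the block form, which is linear
    algebra ([Sp_doublingP]): the columns of A K are sums and differences of
    columns of A, and the only relation of the block form not visible there,
    A24 = - A11^T, follows from A being symplectic.

    The intertwining relation holds for functions in L^2 only, so the functions at
    hand have to be square-integrable. The class [decaying] of measurable functions
    whose squared modulus is bounded by a multiple of the product of the
    1 / (1 + t_i ^+ 2) serves this purpose, and the Gaussian has to be shown to be
    a Schwartz function ([schwartz_gauss]). *)

(** * Borel sets and boxes of R^n *)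

Lemma measurable_cV_map (R : realType) (m n : nat) (h : 'cV[R]_m -> 'cV[R]_n) :
  (forall i, measurable_fun setT (fun t => h t i 0)) -> measurable_fun setT h.
Proof.
move=> mh; apply: (@measurability _ _ _ _ setT h (@matrix_cylinder _ R n 1)) => //.
move=> _ [_ [i [j [B [mB ->]]]] <-].
by rewrite setTI -comp_preimage /comp (ord1 j) -[X in measurable X]setTI; exact: mh.
Qed.

Definition box (R : realType) (n : nat) (c : 'cV[R]_n) (e : R) : set 'cV[R]_n :=
  [set t | forall i, ball (c i 0) e (t i 0)].

Lemma measurable_box (R : realType) (n : nat) (c : 'cV[R]_n) (e : R) :
  measurable (box c e).
Proof.
have -> : box c e = \bigcap_(i in [set: 'I_n])
    ((fun t : 'cV[R]_n => t i 0) @^-1` ball (c i 0) e).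
  by apply/seteqP; split=> t /= h i *; apply: h.
apply: fin_bigcap_measurable => [|i _]; first exact: finite_finset.
rewrite -[X in measurable X]setTI; apply: measurable_cV_coord => //.
by rewrite ball_itv; exact: measurable_itv.
Qed.

Lemma nbhs_box (R : realType) (n : nat) (c : 'cV[R]_n) (U : set 'cV[R]_n) :
  nbhs c U -> exists2 e : R, 0 < e & box c e `<=` U.
Proof.
move=> /nbhs_ballP[e e0 eU]; exists e => // t bt; apply: eU; split=> // i j.
by rewrite (ord1 j); exact: bt.
Qed.

(** The sigma-algebra generated by the coordinates contains the open sets because
    the topology of R^n has a countable basis of boxes. *)
Lemma open_measurable_cV (R : realType) (n : nat) (U : set 'cV[R]_n) :
  open U -> measurable U.
Proof.
move=> oU.
(* The boxes with rational centre and radius 1 / (k + 1) form a countable basis. *)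
pose qbox (qk : 'cV[rat]_n * nat) :=
  box (map_mx ratr qk.1 : 'cV[R]_n) (qk.2.+1%:R^-1).
have -> : U = \bigcup_(qk in [set qk | qbox qk `<=` U]) qbox qk.
  apply/seteqP; split=> [t Ut|t [qk /= sub]]; last exact: sub.
  have [e e0 eU] := nbhs_box (open_nbhs_nbhs (conj oU Ut)).
  have [k kP] : exists k : nat, (k.+1%:R^-1 : R) < e / 2.
    exists (Num.truncn (e / 2)^-1).
    by rewrite invf_plt ?posrE ?divr_gt0// truncnS_gt.
  have [r [r0 rk rE]] : exists r : R, [/\ 0 < r, r < e / 2 & r = k.+1%:R^-1].
    by exists k.+1%:R^-1; rewrite invr_gt0 ltr0n.
  have /choice[q qP] : forall i, exists q : rat, `|t i 0 - ratr q| < r.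
    move=> i; have tr : t i 0 - r < t i 0 + r by lra.
    have [q] := rat_in_itvoo tr; rewrite in_itv /= => /andP[q1 q2]; exists q.
    by rewrite ltr_norml; apply/andP; split; lra.
  exists (\col_i q i, k) => /=; rewrite /qbox /= -rE.
    move=> s /= bs; apply: eU => i; move: (bs i) (qP i).
    rewrite -!ball_normE /= !mxE => h1 h2.
    rewrite (_ : t i 0 - s i 0 =
      (t i 0 - ratr (q i)) + (ratr (q i) - s i 0)); last by ring.
    by rewrite (le_lt_trans (ler_normD _ _))//; lra.
  by move=> i; rewrite -ball_normE /= !mxE distrC.
rewrite bigcup_mkcond; apply: countable_bigcupT_measurable => [|qk].
  exact: countableP.
by case: ifP => // _; exact: measurable_box.
Qed.

Lemma continuous_measurable_cV (R : realType) (n : nat) (g : 'cV[R]_n -> R) :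
  continuous g -> measurable_fun setT g.
Proof.
move=> /continuousP cg; apply: (measurability _ (RGenOpens.measurableE R)).
move=> _ [_ [a [b ->] <-]]; rewrite setTI; apply: open_measurable_cV.
by apply: cg; exact: interval_open.
Qed.

Lemma cV_cons0 (R : realType) (n : nat) (p : measurableTypeR R * 'cV[R]_n) :
  cV_cons p ord0 0 = p.1.
Proof. by have /(congr1 fst) := cV_consK p. Qed.

Lemma cV_uncons_tailE (R : realType) (n : nat) (v : 'cV[R]_n.+1) (i : 'I_n) :
  (cV_uncons v).2 i 0 = v (lift ord0 i) 0.
Proof. by rewrite mxE; congr (v _ _); exact/val_inj. Qed.

Lemma cV_consS (R : realType) (n : nat) (p : measurableTypeR R * 'cV[R]_n) (i : 'I_n) :
  cV_cons p (lift ord0 i) 0 = p.2 i 0.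
Proof. by rewrite -cV_uncons_tailE cV_consK. Qed.

Lemma lebesgue_box (R : realType) (n : nat) (c : 'cV[R]_n) (e : R) :
  0 < e -> lebesgue_cV R n (box c e) = ((e *+ 2) ^+ n)%:E.
Proof.
move=> e0; elim: n c => [|n IH] c.
  by rewrite /= diracE (_ : _ \in _)// inE => -[].
rewrite /= /lebesgue_step /pushforward.
rewrite (_ : @cV_cons R n @^-1` _ = ball (c 0 0) e `*` box (cV_uncons c).2 e); last first.
  apply/seteqP; split=> -[x v].
    move=> h; split=> [|i] /=; first by have := h 0; rewrite cV_cons0.
    by have := h (lift ord0 i); rewrite cV_consS -cV_uncons_tailE.
  case=> /= h1 h2 i; case: (unliftP ord0 i) => [k ->|->].
    by rewrite cV_consS -cV_uncons_tailE; exact: h2.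
  by rewrite cV_cons0.
rewrite product_measure1E//=; last 2 first.
- by rewrite ball_itv; exact: measurable_itv.
- exact: measurable_box.
by rewrite IH lebesgue_measure_ball ?ltW// -EFinM exprS.
Qed.

(** Where a continuous function is nonzero it is so on a whole box, and boxes have
    positive measure. *)
Lemma ae_eq0_continuous (R : realType) (n : nat) (g : 'cV[R]_n -> R) :
  continuous g -> {ae lebesgue_cV R n, forall t, g t = 0} -> forall t, g t = 0.
Proof.
move=> cg [N [mN N0 sN]] t; apply/eqP; apply: contraT => gt0.
have : nbhs t [set s | g s != 0].
  have := cg t [set y | y != 0]; apply; apply: open_nbhs_nbhs; split=> //.
move=> /nbhs_box[e e0 es].
have : (lebesgue_cV R n (box t e) <= lebesgue_cV R n N)%E.
  apply: le_measure; rewrite ?inE//; first exact: measurable_box.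
  by move=> s /es /= gs0; apply: sN => /= gs; rewrite gs eqxx in gs0.
by rewrite N0 lebesgue_box// lee_fin leNgt exprn_gt0// pmulrn_lgt0.
Qed.

(** * Square-integrability from polynomial decay *)

Definition decay_weight (R : realType) (n : nat) (t : 'cV[R]_n) : R :=
  \prod_(i < n) (oneDsqr (t i 0))^-1.

Lemma decay_weight_ge0 (R : realType) (n : nat) (t : 'cV[R]_n) : 0 <= decay_weight t.
Proof. by apply: prodr_ge0 => i _; rewrite invr_ge0 (le_trans ler01). Qed.

Lemma measurable_decay_weight (R : realType) (n : nat) :
  measurable_fun setT (@decay_weight R n).
Proof.
apply: measurable_prod => i _.
apply: (@measurableT_comp _ _ _ _ _ _ (fun x : R => (oneDsqr x)^-1)).
  by apply: continuous_measurable_fun; exact: continuous_oneDsqrV.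
exact: measurable_cV_coord.
Qed.

Lemma integral_oneDsqrV (R : realType) :
  (\int[@lebesgue_measure R]_x ((oneDsqr x)^-1)%:E = pi%:E)%E.
Proof.
rewrite ge0_symfun_integralT//=.
- rewrite (_ : [set x | _] = `[0, +oo[%classic); last first.
    by apply/seteqP; split => x/=; rewrite in_itv/= andbT.
  by rewrite integral0y_oneDsqr -EFinM mulrCA divff// mulr1.
- exact: continuous_oneDsqrV.
- by move=> x/=; rewrite /oneDsqr sqrrN.
Qed.

(** The weight is a product of functions of one coordinate, each of integral pi, so
    Tonelli computes its integral by induction on the dimension. *)
Lemma integral_decay_weight (R : realType) (n : nat) :
  (\int[lebesgue_cV R n]_t (decay_weight t)%:E = (pi ^+ n)%:E)%E.
Proof.
elim: n => [|n IH].
  rewrite integral_dirac//; last by apply/measurable_EFinP; exact: measurable_decay_weight.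
  by rewrite diracT mul1e /decay_weight big_ord0.
rewrite /= ge0_integral_pushforward//; last 2 first.
- by apply/measurable_EFinP; exact: measurable_decay_weight.
- by move=> t _; rewrite lee_fin decay_weight_ge0.
rewrite preimage_setT /=.
rewrite (_ : (fun x => _) = fun p : measurableTypeR R * 'cV[R]_n =>
   ((oneDsqr (p.1 : R))^-1 * decay_weight p.2)%:E); last first.
  apply/funext => p /=; rewrite /decay_weight big_ord_recl cV_cons0.
  by congr ((_ * _)%:E); apply: eq_bigr => i _; rewrite cV_consS.
rewrite fubini_tonelli1//=; last 2 first.
- apply/measurable_EFinP; apply: measurable_funM.
    apply: (measurableT_comp (f := fun x : R => (oneDsqr x)^-1)); last first.
      exact: measurable_fst.
    by apply: continuous_measurable_fun; exact: continuous_oneDsqrV.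
  apply: measurableT_comp; last exact: measurable_snd.
  exact: measurable_decay_weight.
- by move=> p; rewrite lee_fin mulr_ge0 ?decay_weight_ge0// invr_ge0 (le_trans ler01).
rewrite /fubini_F /=.
under eq_integral => x _.
  under eq_integral do rewrite EFinM.
  rewrite ge0_integralZl//=; last 2 first.
  - by apply/measurable_EFinP; exact: measurable_decay_weight.
  - by move=> t _; rewrite lee_fin decay_weight_ge0.
  rewrite IH; over.
rewrite ge0_integralZr//=; last 2 first.
- apply/measurable_EFinP.
  by apply: continuous_measurable_fun; exact: continuous_oneDsqrV.
- by rewrite lee_fin exprn_ge0// pi_ge0.
by rewrite integral_oneDsqrV -EFinM exprS.
Qed.

Definition sqnormc (R : realType) (z : R[i]) : R := complex.Re z ^+ 2 + complex.Im z ^+ 2.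

Lemma sqnormc_ge0 (R : realType) (z : R[i]) : 0 <= sqnormc z.
Proof. by rewrite addr_ge0 ?sqr_ge0. Qed.

Lemma sqnormcM (R : realType) (z w : R[i]) : sqnormc (z * w) = sqnormc z * sqnormc w.
Proof. by case: z w => [a b] [x y]; rewrite /sqnormc /=; ring. Qed.

Lemma sqnormcB_le (R : realType) (z w : R[i]) :
  sqnormc (z - w) <= 2 * (sqnormc z + sqnormc w).
Proof.
case: z w => [a b] [x y]; rewrite /sqnormc /=.
by have := sqr_ge0 (a + x); have := sqr_ge0 (b + y); nra.
Qed.

Lemma sqnormc_conj (R : realType) (z : R[i]) : sqnormc (conjc z) = sqnormc z.
Proof. by case: z => a b; rewrite /sqnormc /= sqrrN. Qed.

Lemma measurable_sqnormc (R : realType) (n : nat) (F : cfun R n) :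
  measurable_fun setT (fun t => complex.Re (F t)) ->
  measurable_fun setT (fun t => complex.Im (F t)) ->
  measurable_fun setT (fun t => (sqnormc (F t))%:E).
Proof.
move=> mRe mIm; apply/measurable_EFinP; apply: measurable_funD;
  exact: measurable_funX.
Qed.

(** A subclass of L^2 that contains the Schwartz functions and, being given by a
    pointwise bound, is stable under translations, modulations, linear combinations
    and tensor products by elementary inequalities, with no change of variables in
    an integral. *)
Definition decaying (R : realType) (n : nat) (F : cfun R n) : Prop :=
  [/\ measurable_fun setT (fun t => complex.Re (F t)),
      measurable_fun setT (fun t => complex.Im (F t)) &
      exists C : R, forall t, sqnormc (F t) <= C * decay_weight t].

Lemma decaying_L2 (R : realType) (n : nat) (F : cfun R n) : decaying F -> L2 F.
Proof.
case=> mRe mIm [C FC]; split=> //.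
apply: (@le_lt_trans _ _ (\int[lebesgue_cV R n]_t (`|C|%:E * (decay_weight t)%:E))%E).
  apply: ge0_le_integral => //.
  - by move=> t _; rewrite lee_fin addr_ge0 ?sqr_ge0.
  - exact: measurable_sqnormc.
  - under eq_fun do rewrite -EFinM.
    apply/measurable_EFinP; apply: measurable_funM => //.
    exact: measurable_decay_weight.
  - move=> t _; rewrite -EFinM lee_fin; apply: le_trans (FC t) _.
    by rewrite ler_wpM2r ?decay_weight_ge0// ler_norm.
rewrite ge0_integralZl//=.
- by rewrite integral_decay_weight -EFinM ltry.
- by apply/measurable_EFinP; exact: measurable_decay_weight.
- by move=> t _; rewrite lee_fin decay_weight_ge0.
Qed.

Lemma L2_inner_self_eq0 (R : realType) (n : nat) (F : cfun R n) :
  L2 F -> L2_inner F F = 0 -> eq_ae F (fun=> 0).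
Proof.
move=> [mRe mIm Foo] /eqP; rewrite eq_complex => /andP[/eqP /= F0 _].
have mF := measurable_sqnormc mRe mIm.
have : (\int[lebesgue_cV R n]_t `|(sqnormc (F t))%:E| = 0)%E.
  rewrite (eq_integral (fun t => (sqnormc (F t))%:E)); last first.
    by move=> t _; rewrite gee0_abs// lee_fin addr_ge0 ?sqr_ge0.
  rewrite -[LHS]fineK; last first.
    rewrite ge0_fin_numE//; apply: integral_ge0 => t _.
    by rewrite lee_fin addr_ge0 ?sqr_ge0.
  congr (_%:E); rewrite -{}[RHS]F0 /Rintegral; congr fine.
  apply: eq_integral => t _; congr (_%:E); rewrite /sqnormc.
  by case: (F t) => a b /=; ring.
move=> /(ae_eq_integral_abs _ measurableT mF); apply: filterS => t /(_ I) /= [].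
rewrite /sqnormc; case: (F t) => a b /= /eqP.
rewrite paddr_eq0 ?sqr_ge0// !sqrf_eq0 => /andP[/eqP -> /eqP ->].
by [].
Qed.

(** * Measurable and continuous complex-valued functions *)

Lemma ReM (R : realType) (z w : R[i]) :
  complex.Re (z * w) = complex.Re z * complex.Re w - complex.Im z * complex.Im w.
Proof. by case: z w => [a b] [x y]. Qed.

Lemma ImM (R : realType) (z w : R[i]) :
  complex.Im (z * w) = complex.Re z * complex.Im w + complex.Im z * complex.Re w.
Proof. by case: z w => [a b] [x y]. Qed.

Lemma ReB (R : realType) (z w : R[i]) :
  complex.Re (z - w) = complex.Re z - complex.Re w.
Proof. by case: z w => [a b] [x y]. Qed.

Lemma ImB (R : realType) (z w : R[i]) :
  complex.Im (z - w) = complex.Im z - complex.Im w.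
Proof. by case: z w => [a b] [x y]. Qed.

Lemma ReJ (R : realType) (z : R[i]) : complex.Re (conjc z) = complex.Re z.
Proof. by case: z. Qed.

Lemma ImJ (R : realType) (z : R[i]) : complex.Im (conjc z) = - complex.Im z.
Proof. by case: z. Qed.

Lemma conjcM (R : realType) (z w : R[i]) : conjc (z * w) = conjc z * conjc w.
Proof. exact: (rmorphM conjc). Qed.

Lemma expiD (R : realType) (x y : R) : expi (x + y) = expi x * expi y.
Proof. by apply/eqP; rewrite eq_complex /= cosD sinD [sin x * _ + _]addrC !eqxx. Qed.

Lemma expiN (R : realType) (x : R) : expi (- x) = conjc (expi x).
Proof. by rewrite /expi cosN sinN. Qed.

Lemma expi0 (R : realType) : expi 0 = 1 :> R[i].
Proof. by rewrite /expi cos0 sin0. Qed.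

Lemma sqnormc_expi (R : realType) (x : R) : sqnormc (expi x) = 1.
Proof. by rewrite /sqnormc /= cos2Dsin2. Qed.

Definition cmeasurable (R : realType) (n : nat) (F : cfun R n) : Prop :=
  measurable_fun setT (fun t => complex.Re (F t)) /\
  measurable_fun setT (fun t => complex.Im (F t)).

Definition ccontinuous (R : realType) (n : nat) (F : cfun R n) : Prop :=
  continuous (fun t => complex.Re (F t)) /\ continuous (fun t => complex.Im (F t)).

Lemma ccontinuous_measurable (R : realType) (n : nat) (F : cfun R n) :
  ccontinuous F -> cmeasurable F.
Proof. by case=> cR cI; split; exact: continuous_measurable_cV. Qed.

Lemma cmeasurableM (R : realType) (n : nat) (F G : cfun R n) :
  cmeasurable F -> cmeasurable G -> cmeasurable (fun t => F t * G t).
Proof.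
case=> FR FI [GR GI]; split.
  by under eq_fun do rewrite ReM; apply: measurable_funB; exact: measurable_funM.
by under eq_fun do rewrite ImM; apply: measurable_funD; exact: measurable_funM.
Qed.

Lemma cmeasurableJ (R : realType) (n : nat) (F : cfun R n) :
  cmeasurable F -> cmeasurable (fun t => conjc (F t)).
Proof.
case=> FR FI; split; first by under eq_fun do rewrite ReJ.
by under eq_fun do rewrite ImJ; exact: measurable_funN.
Qed.

Lemma cmeasurableB (R : realType) (n : nat) (F G : cfun R n) :
  cmeasurable F -> cmeasurable G -> cmeasurable (fun t => F t - G t).
Proof.
case=> FR FI [GR GI]; split.
  by under eq_fun do rewrite ReB; exact: measurable_funB.
by under eq_fun do rewrite ImB; exact: measurable_funB.
Qed.

Lemma ccontinuousM (R : realType) (n : nat) (F G : cfun R n) :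
  ccontinuous F -> ccontinuous G -> ccontinuous (fun t => F t * G t).
Proof.
case=> FR FI [GR GI]; split.
  under eq_fun do rewrite ReM.
  move=> t.
  exact: (continuousB (continuousM (FR t) (GR t)) (continuousM (FI t) (GI t))).
under eq_fun do rewrite ImM.
move=> t.
exact: (continuousD (continuousM (FR t) (GI t)) (continuousM (FI t) (GR t))).
Qed.

Lemma ccontinuousB (R : realType) (n : nat) (F G : cfun R n) :
  ccontinuous F -> ccontinuous G -> ccontinuous (fun t => F t - G t).
Proof.
case=> FR FI [GR GI]; split.
  by under eq_fun do rewrite ReB; move=> t; apply: (continuousB (FR t) (GR t)).
by under eq_fun do rewrite ImB; move=> t; apply: (continuousB (FI t) (GI t)).
Qed.

Lemma ccontinuous_cst (R : realType) (n : nat) (c : R[i]) :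
  ccontinuous (fun _ : 'cV[R]_n => c).
Proof. by split; exact: cst_continuous. Qed.

Lemma eq_ae_ccontinuous (R : realType) (n : nat) (F G : cfun R n) :
  ccontinuous F -> ccontinuous G -> eq_ae (fun t => F t - G t) (fun=> 0) -> F = G.
Proof.
move=> cF cG FG; have [cR cI] := ccontinuousB cF cG.
have R0 := ae_eq0_continuous cR
  (filterS (fun t => @congr1 _ _ (@complex.Re R) _ _) FG).
have I0 := ae_eq0_continuous cI
  (filterS (fun t => @congr1 _ _ (@complex.Im R) _ _) FG).
apply/funext => t; apply/eqP; rewrite -subr_eq0 eq_complex /=.
by rewrite R0 I0 eqxx.
Qed.

(** * The dot product *)

Lemma dotc_col_mx (R : realType) (m n : nat) (x y : 'cV[R]_m) (a b : 'cV[R]_n) :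
  dotc (col_mx x a) (col_mx y b) = dotc x y + dotc a b.
Proof.
rewrite /dotc big_split_ord /=; congr (_ + _); apply: eq_bigr => i _.
  by rewrite !col_mxEu.
by rewrite !col_mxEd.
Qed.

Lemma dotc0l (R : realType) (n : nat) (x : 'cV[R]_n) : dotc 0 x = 0.
Proof. by apply: big1 => i _; rewrite mxE mul0r. Qed.

Lemma dotc0r (R : realType) (n : nat) (x : 'cV[R]_n) : dotc x 0 = 0.
Proof. by apply: big1 => i _; rewrite mxE mulr0. Qed.

Lemma dotcNl (R : realType) (n : nat) (x y : 'cV[R]_n) : dotc (- x) y = - dotc x y.
Proof. by rewrite -sumrN; apply: eq_bigr => i _; rewrite mxE mulNr. Qed.

Lemma dotcNr (R : realType) (n : nat) (x y : 'cV[R]_n) : dotc x (- y) = - dotc x y.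
Proof. by rewrite -sumrN; apply: eq_bigr => i _; rewrite mxE mulrN. Qed.

Lemma dotcDl (R : realType) (n : nat) (x y z : 'cV[R]_n) :
  dotc (x + y) z = dotc x z + dotc y z.
Proof. by rewrite -big_split; apply: eq_bigr => i _; rewrite mxE mulrDl. Qed.

Lemma dotcZr (R : realType) (n : nat) (a : R) (x y : 'cV[R]_n) :
  dotc x (a *: y) = a * dotc x y.
Proof. by rewrite mulr_sumr; apply: eq_bigr => i _; rewrite mxE mulrCA. Qed.

Lemma dotc_ge0 (R : realType) (n : nat) (x : 'cV[R]_n) : 0 <= dotc x x.
Proof. by apply: sumr_ge0 => i _; rewrite -expr2 sqr_ge0. Qed.

Lemma dotc_eq0 (R : realType) (n : nat) (x : 'cV[R]_n) : dotc x x = 0 -> x = 0.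
Proof.
move=> /psumr_eq0P xx0; apply/matrixP => i j; rewrite ord1 mxE; apply/eqP.
by rewrite -sqrf_eq0 expr2 xx0// => k _; rewrite -expr2 sqr_ge0.
Qed.

(** * Gaussians are Schwartz functions *)

(** Polynomial functions of the coordinates. Products of such functions with the
    Gaussian are closed under directional derivatives and multiplication by
    monomials, the two operations that occur in the Schwartz seminorms. *)
Inductive polyfun (R : realType) (d : nat) : ('cV[R]_d -> R) -> Prop :=
| polyfun_cst c : polyfun (cst c)
| polyfun_coord i : polyfun (fun t => t i 0)
| polyfunD p q : polyfun p -> polyfun q -> polyfun (p \+ q)
| polyfunM p q : polyfun p -> polyfun q -> polyfun (p \* q).

Lemma polyfun_sum (R : realType) (d : nat) (I : Type) (s : seq I) (F : I -> 'cV[R]_d -> R) :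
  (forall i, polyfun (F i)) -> polyfun (fun t => \sum_(i <- s) F i t).
Proof.
move=> pF; elim: s => [|i s IH].
  by under eq_fun do rewrite big_nil; exact: polyfun_cst.
by under eq_fun do rewrite big_cons; exact: polyfunD.
Qed.

Lemma polyfun_prod (R : realType) (d : nat) (I : Type) (s : seq I) (F : I -> 'cV[R]_d -> R) :
  (forall i, polyfun (F i)) -> polyfun (fun t => \prod_(i <- s) F i t).
Proof.
move=> pF; elim: s => [|i s IH].
  by under eq_fun do rewrite big_nil; exact: polyfun_cst.
by under eq_fun do rewrite big_cons; exact: polyfunM.
Qed.

Lemma polyfunX (R : realType) (d : nat) (p : 'cV[R]_d -> R) n :
  polyfun p -> polyfun (fun t => p t ^+ n).
Proof.
move=> pp; elim: n => [|n IH]; first exact: polyfun_cst.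
by under eq_fun do rewrite exprS; exact: polyfunM.
Qed.

Lemma polyfun_differentiable (R : realType) (d : nat) (p : 'cV[R]_d -> R) x :
  polyfun p -> differentiable p x.
Proof.
elim=> {p} [c|i|p q _ dp _ dq|p q _ dp _ dq].
- exact: differentiable_cst.
- exact: differentiable_coord.
- exact: differentiableD.
- exact: differentiableM.
Qed.

Lemma polyfun_continuous (R : realType) (n : nat) (p : 'cV[R]_n -> R) :
  polyfun p -> continuous p.
Proof.
by move=> pp t; apply: differentiable_continuous; exact: polyfun_differentiable.
Qed.

Lemma polyfun_is_derive (R : realType) (d : nat) (v : 'cV[R]_d) (p : 'cV[R]_d -> R) :
  polyfun p -> exists2 p', polyfun p' & forall x, is_derive x v p (p' x).
Proof.
elim=> {p} [c|i|p q pp [p' pp' dp] pq [q' pq' dq]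
           |p q pp [p' pp' dp] pq [q' pq' dq]].
- exists (cst 0) => [|x]; first exact: polyfun_cst.
  exact: is_derive_cst.
- exists (cst (v i 0)) => [|x]; first exact: polyfun_cst.
  have dq : (h^-1 *: ((h *: v + x) i 0 - x i 0) : R) @[h --> (0 : R)^'] --> v i 0.
    apply: cvg_near_cst; near=> h; rewrite !mxE addrK [LHS]mulrA mulVf ?mul1r//.
    by near: h; exact: nbhs_dnbhs_neq.
  by apply: DeriveDef; [apply: cvgP; exact: dq|apply: cvg_lim => //; exact: dq].
- by exists (p' \+ q') => [|x]; [exact: polyfunD|exact: is_deriveD].
- exists (p \* q' \+ q \* p') => [|x]; first by apply: polyfunD; exact: polyfunM.
  exact: is_deriveM.
Unshelve. all: by end_near.
Qed.

Lemma polyfun_growth (R : realType) (d : nat) (p : 'cV[R]_d -> R) :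
  polyfun p -> exists C k, 0 <= C /\ forall t, `|p t| <= C * (1 + dotc t t) ^+ k.
Proof.
have ge1 (t : 'cV[R]_d) k : 1 <= (1 + dotc t t) ^+ k.
  by apply: exprn_ege1; rewrite lerDl dotc_ge0.
elim=> {p} [c|i|p q _ [C [k [C0 bp]]] _ [C' [k' [C'0 bq]]]
           |p q _ [C [k [C0 bp]]] _ [C' [k' [C'0 bq]]]].
- by exists `|c|, 0%N; split=> // t; rewrite expr0 mulr1.
- exists 1, 1%N; split=> // t; rewrite mul1r expr1.
  have : t i 0 ^+ 2 <= dotc t t.
    rewrite /dotc (bigD1 i)//= -expr2 lerDl; apply: sumr_ge0 => j _.
    by rewrite -expr2 sqr_ge0.
  rewrite -(real_normK (num_real _)) => h.
  by have := sqr_ge0 (`|t i 0| - 1); nra.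
- exists (C + C'), (k + k')%N; split=> [|t]; first exact: addr_ge0.
  rewrite (le_trans (ler_normD _ _))// mulrDl exprD; apply: lerD.
    by rewrite (le_trans (bp t))// ler_wpM2l// ler_peMr// (le_trans ler01).
  by rewrite (le_trans (bq t))// ler_wpM2l// ler_peMl// (le_trans ler01).
- exists (C * C'), (k + k')%N; split=> [|t]; first exact: mulr_ge0.
  by rewrite normrM exprD mulrACA ler_pM.
Qed.

Definition gauss (R : realType) (d : nat) (t : 'cV[R]_d) : R := expR (- dotc t t).

Lemma polyfun_opp_dotc (R : realType) (d : nat) : polyfun (fun t : 'cV[R]_d => - dotc t t).
Proof.
have -> : (fun t : 'cV[R]_d => - dotc t t) = cst (-1) \* (fun t => dotc t t).
  by apply/funext => t /=; rewrite mulN1r.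
apply: polyfunM; first exact: polyfun_cst.
by apply: polyfun_sum => i; apply: polyfunM; exact: polyfun_coord.
Qed.

Lemma expR_dominates (R : realType) (s : R) k : 0 <= s ->
  (1 + s) ^+ k <= k.+1%:R ^+ k.+1 * expR s.
Proof.
move=> s0; apply: (@le_trans _ _ ((1 + s) ^+ k.+1)).
  by rewrite exprS ler_peMl ?exprn_ge0 ?lerDl ?addr_ge0.
(* By 1 + u <= expR u at u = s / (k + 1), raised to the power k + 1. *)
have -> : expR s = expR (s / k.+1%:R) ^+ k.+1.
  by rewrite -expRM_natl mulrC divfK ?pnatr_eq0.
rewrite -exprMn lerXn2r ?nnegrE ?addr_ge0 ?mulr_ge0 ?expR_ge0//.
apply: (@le_trans _ _ (k.+1%:R * (1 + s / k.+1%:R))); last first.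
  by rewrite ler_wpM2l// expR_ge1Dx// divr_ge0.
by rewrite mulrDr mulr1 mulrCA divff ?pnatr_eq0// mulr1 lerD2r ler1n.
Qed.

Lemma polyfun_gauss_bounded (R : realType) (d : nat) (p : 'cV[R]_d -> R) :
  polyfun p -> exists C, forall t, `|p t * gauss t| <= C.
Proof.
move=> /polyfun_growth[C [k [C0 bp]]]; exists (C * k.+1%:R ^+ k.+1) => t.
rewrite normrM /gauss expRN [`|_^-1|]ger0_norm ?invr_ge0 ?expR_ge0//.
rewrite ler_pdivrMr ?expR_gt0// -mulrA (le_trans (bp t))// ler_wpM2l//.
by apply: expR_dominates; exact: dotc_ge0.
Qed.

Lemma polyfun_gauss_differentiable (R : realType) (d : nat) (p : 'cV[R]_d -> R) x :
  polyfun p -> differentiable (fun t => p t * gauss t) x.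
Proof.
move=> pp; apply: differentiableM; first exact: polyfun_differentiable.
apply: (@differentiable_comp _ _ _ _ (fun t => - dotc t t) expR).
  exact/polyfun_differentiable/polyfun_opp_dotc.
by apply/derivable1_diffP; exact: derivable_expR.
Qed.

Lemma gauss_is_derive (R : realType) (d : nat) (v : 'cV[R]_d) :
  exists2 q, polyfun q & forall x, is_derive x v (@gauss R d) (q x * gauss x).
Proof.
have [q pq dq] := polyfun_is_derive v (polyfun_opp_dotc R d); exists q => // x.
have dN : differentiable (fun t : 'cV[R]_d => - dotc t t) x.
  exact/polyfun_differentiable/polyfun_opp_dotc.
have de (y : R) : differentiable (@expR R) y.
  by apply/derivable1_diffP; exact: derivable_expR.
have dg : differentiable (@gauss R d) x.
  exact: (@differentiable_comp _ _ _ _ (fun t => - dotc t t) expR).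
apply: DeriveDef; first exact/diff_derivable.
rewrite deriveE// (@diff_comp _ _ _ _ (fun t => - dotc t t) expR)//=.
rewrite diff1E//= -deriveE//.
by rewrite (derive_val (is_derive := dq x)) derive1E derive_val.
Qed.

Lemma partials_polyfun_gauss (R : realType) (d : nat) (s : seq 'I_d) (p : 'cV[R]_d -> R) :
  polyfun p -> exists2 q, polyfun q &
    partials s (fun t => p t * gauss t) = fun t => q t * gauss t.
Proof.
move=> pp; elim: s => [|i s [q pq E]] /=; first by exists p.
have [q' pq' dq] := polyfun_is_derive (delta_mx i 0) pq.
have [g' pg' dg] := gauss_is_derive (delta_mx i 0 : 'cV[R]_d).
exists (q \* g' \+ q') => [|]; first by apply: polyfunD => //; exact: polyfunM.
apply/funext => x; rewrite E.
have D := is_deriveM (dq x) (dg x).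
rewrite (derive_val (is_derive := D)) /=.
by rewrite -[_ *: _]/(q x * _) -[gauss x *: _]/(gauss x * _); ring.
Qed.

Lemma schwartz_polyfun_gauss (R : realType) (d : nat) (p : 'cV[R]_d -> R) :
  polyfun p -> schwartz_real (fun t => p t * gauss t).
Proof.
move=> pp s; have [q pq ->] := partials_polyfun_gauss s pp; split.
- move=> x; apply: differentiable_continuous.
  exact: polyfun_gauss_differentiable.
- by move=> i x; apply: diff_derivable; exact: polyfun_gauss_differentiable.
- move=> a; have /polyfun_gauss_bounded[C bC] :
    polyfun ((fun x : 'cV[R]_d => \prod_(i < d) x i 0 ^+ a i) \* q).
    by apply: polyfunM => //; apply: polyfun_prod => i; apply/polyfunX/polyfun_coord.
  by exists C => x; rewrite mulrA; exact: bC.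
Qed.

Lemma schwartz_gauss (R : realType) (d : nat) :
  schwartz (fun t : 'cV[R]_d => (gauss t)%:C).
Proof.
split=> /=.
  have -> : (fun t : 'cV[R]_d => gauss t) = (fun t => cst 1 t * gauss t).
    by apply/funext => t /=; rewrite mul1r.
  by apply: schwartz_polyfun_gauss; exact: polyfun_cst.
have -> : (fun=> 0) = (fun t : 'cV[R]_d => cst 0 t * gauss t).
  by apply/funext => t /=; rewrite mul0r.
by apply: schwartz_polyfun_gauss; exact: polyfun_cst.
Qed.

(** * Time-frequency shifts of decaying functions *)

Lemma polyfun_character (R : realType) (n : nat) (c : R) (xi : 'cV[R]_n) :
  polyfun (fun t => c * dotc xi t).
Proof.
apply: (polyfunM (polyfun_cst _ c)); apply: polyfun_sum => i.
by apply: (polyfunM (polyfun_cst _ _)); exact: polyfun_coord.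
Qed.

Lemma ccontinuous_expi (R : realType) (n : nat) (p : 'cV[R]_n -> R) :
  polyfun p -> ccontinuous (fun t => expi (p t)).
Proof.
move=> pp; split=> t.
  apply: (@continuous_comp _ _ _ p cos); first exact: polyfun_continuous.
  exact: continuous_cos.
apply: (@continuous_comp _ _ _ p sin); first exact: polyfun_continuous.
exact: continuous_sin.
Qed.

Lemma decayingM (R : realType) (n : nat) (G F : cfun R n) (B : R) :
  cmeasurable G -> (forall t, sqnormc (G t) <= B) ->
  decaying F -> decaying (fun t => G t * F t).
Proof.
move=> mG GB [FR FI [C FC]].
have [mR mI] := cmeasurableM mG (conj FR FI); split=> //.
exists (B * C) => t; rewrite sqnormcM -mulrA.
by rewrite ler_pM ?sqnormc_ge0.
Qed.

Lemma decayingB (R : realType) (n : nat) (F G : cfun R n) :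
  decaying F -> decaying G -> decaying (fun t => F t - G t).
Proof.
move=> [FR FI [C FC]] [GR GI [C' GC]].
have [mR mI] := cmeasurableB (conj FR FI) (conj GR GI); split=> //.
exists (2 * (C + C')) => t; rewrite (le_trans (sqnormcB_le _ _))//.
by rewrite -mulrA ler_wpM2l// mulrDl lerD.
Qed.

(** Coordinatewise this is the inequality
    1 + t ^+ 2 <= 2 (1 + x ^+ 2) (1 + (t - x) ^+ 2), of Peetre's type. *)
Lemma decay_weight_translate (R : realType) (n : nat) (x t : 'cV[R]_n) :
  decay_weight (t - x) <= (\prod_(i < n) (2 * oneDsqr (x i 0))) * decay_weight t.
Proof.
rewrite /decay_weight -big_split /=; apply: ler_prod => i _.
rewrite invr_ge0 (le_trans ler01)//= !mxE.
have pos (y : R) : 0 < oneDsqr y by rewrite (lt_le_trans ltr01).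
rewrite ler_pdivlMr// mulrC ler_pdivrMr// /oneDsqr.
set a := t i 0; set b := x i 0; have := sqr_ge0 (a - 2 * b).
by have := sqr_ge0 (b * (a - b)); nra.
Qed.

Lemma decaying_translate (R : realType) (n : nat) (x : 'cV[R]_n) (F : cfun R n) :
  decaying F -> decaying (translate x F).
Proof.
have mt : measurable_fun setT (fun t : 'cV[R]_n => t - x).
  apply: measurable_cV_map => i; under eq_fun do rewrite !mxE.
  by apply: measurable_funD => //; exact: measurable_cV_coord.
move=> [FR FI [C FC]]; split.
- exact: (measurableT_comp FR).
- exact: (measurableT_comp FI).
exists (`|C| * \prod_(i < n) (2 * oneDsqr (x i 0))) => t.
rewrite (le_trans (FC _))// -mulrA (@le_trans _ _ (`|C| * decay_weight (t - x)))//.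
  by rewrite ler_wpM2r ?decay_weight_ge0// ler_norm.
by rewrite ler_wpM2l// decay_weight_translate.
Qed.

Lemma decaying_tfshift (R : realType) (n : nat) (z : 'cV[R]_(n + n)) (F : cfun R n) :
  decaying F -> decaying (tfshift z F).
Proof.
move=> dF; apply: (@decayingM _ _ _ _ 1); last exact: decaying_translate.
  by apply/ccontinuous_measurable/ccontinuous_expi/polyfun_character.
by move=> t; rewrite sqnormc_expi.
Qed.

Lemma schwartz_real_decay (R : realType) (d : nat) (g : 'cV[R]_d -> R) :
  schwartz_real g ->
  continuous g /\ exists C, forall t, g t ^+ 2 <= C * decay_weight t.
Proof.
move=> /(_ [::])[cg _ bg]; split=> //.
(* Expanding the product over i of 1 + t_i ^+ 2 over subsets S gives the squares
   of the monomials with exponents in {0, 1}, each controlled by one seminorm. *)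
have /choice[C bC] := fun S : {set 'I_d} => bg (fun i => nat_of_bool (i \in S)).
exists (\sum_(S : {set 'I_d}) C S ^+ 2) => t.
rewrite /decay_weight prodfV ler_pdivlMr; last first.
  by apply: prodr_gt0 => i _; rewrite (lt_le_trans ltr01).
under [X in _ * X]eq_bigr do rewrite /oneDsqr addrC.
rewrite bigA_distr mulr_sumr; apply: ler_sum => S _.
rewrite (_ : _ * _ = `|(\prod_(i < d) t i 0 ^+ (i \in S)) * g t| ^+ 2).
  by rewrite lerXn2r ?nnegrE// (le_trans _ (bC S t)).
rewrite real_normK ?num_real// exprMn mulrC -prodrXl; congr (_ * _).
by apply: eq_bigr => i _; case: ifP => _; rewrite ?expr1// expr0 expr1n.
Qed.

Lemma schwartz_decaying (R : realType) (d : nat) (f : cfun R d) :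
  schwartz f -> decaying f.
Proof.
move=> [/schwartz_real_decay[cR [C RC]] /schwartz_real_decay[cI [C' IC]]].
split; try exact: continuous_measurable_cV.
by exists (C + C') => t; rewrite mulrDl lerD.
Qed.

Lemma decaying_tensor_conj (R : realType) (d : nat) (f g : cfun R d) :
  decaying f -> decaying g -> decaying (tensor_conj f g).
Proof.
have mu : measurable_fun setT (@usubmx R d d 1).
  apply: measurable_cV_map => i; under eq_fun do rewrite !mxE.
  exact: measurable_cV_coord.
have md : measurable_fun setT (@dsubmx R d d 1).
  apply: measurable_cV_map => i; under eq_fun do rewrite !mxE.
  exact: measurable_cV_coord.
move=> [fR fI [C fC]] [gR gI [C' gC]].
have [mR mI] : cmeasurable (tensor_conj f g).
  apply: cmeasurableM; last apply: cmeasurableJ.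
    by split; [exact: (measurableT_comp fR)|exact: (measurableT_comp fI)].
  by split; [exact: (measurableT_comp gR)|exact: (measurableT_comp gI)].
split=> //; exists (C * C') => t; rewrite sqnormcM sqnormc_conj.
have -> : decay_weight t = decay_weight (usubmx t) * decay_weight (dsubmx t).
  rewrite /decay_weight big_split_ord /=.
  by congr (_ * _); apply: eq_bigr => i _; rewrite mxE.
by rewrite mulrACA ler_pM ?sqnormc_ge0.
Qed.

Lemma ccontinuous_tfshift_gauss (R : realType) (n : nat) (w : 'cV[R]_(n + n)) :
  ccontinuous (tfshift w (fun s => (gauss s)%:C)).
Proof.
apply: ccontinuousM; first exact/ccontinuous_expi/polyfun_character.
split; last exact: cst_continuous.
rewrite /translate /gauss /=.
have pw : polyfun (fun t => - dotc (t - usubmx w) (t - usubmx w)).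
  have -> : (fun t => - dotc (t - usubmx w) (t - usubmx w)) =
      (fun t => cst (-1) t * \sum_(i < n)
        ((t i 0 + - usubmx w i 0) * (t i 0 + - usubmx w i 0))).
    apply/funext => t; rewrite mulN1r; congr (- _).
    by apply: eq_bigr => i _; rewrite !mxE.
  apply: polyfunM; first exact: polyfun_cst.
  have pc i : polyfun (fun t : 'cV[R]_n => t i 0 + cst (- usubmx w i 0) t).
    by apply: polyfunD; [exact: polyfun_coord|exact: polyfun_cst].
  by apply: polyfun_sum => i; exact: polyfunM.
move=> t; exact: (continuous_comp (@polyfun_continuous _ _ _ pw t)
                                  (@continuous_expR R _)).
Qed.

(** The Gaussian determines a phase-space point from the line spanned by its shift:
    the modulus reveals the position, and then the argument the frequency. *)
Lemma tfshift_gauss_inj (R : realType) (n : nat) (w v : 'cV[R]_(n + n)) (c : R[i]) :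
  sqnormc c = 1 ->
  (forall t, tfshift w (fun s => (gauss s)%:C) t =
             c * tfshift v (fun s => (gauss s)%:C) t) ->
  w = v.
Proof.
move=> c1 E.
have sq0 (x : R) : sqnormc x%:C = x ^+ 2 by rewrite /sqnormc /= expr0n addr0.
(* Moduli: the Gaussians centred at the two positions coincide, and evaluating
   at one centre shows that it is the other. *)
have uE : usubmx w = usubmx v.
  have := congr1 (@sqnormc R) (E (usubmx w)).
  rewrite /tfshift /modulate /translate !sqnormcM !sqnormc_expi c1 !mul1r !sq0 subrr.
  rewrite /gauss dotc0l oppr0 expR0 => /eqP; rewrite eqrXn2 ?expR_ge0//.
  rewrite -expR0 => /eqP/expR_inj/eqP; rewrite eq_sym oppr_eq0 => /eqP/dotc_eq0/eqP.
  by rewrite subr_eq0 => /eqP.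
(* The Gaussian factors cancel, so the two characters agree up to c. *)
have {}E t : expi (2 * pi * dotc (dsubmx w) t) = c * expi (2 * pi * dotc (dsubmx v) t).
  have := E t; rewrite /tfshift /modulate /translate uE mulrA; apply: mulIf.
  by rewrite (inj_eq (@complexI R)) gt_eqF ?expR_gt0.
have cE : c = 1 by have := E 0; rewrite !dotc0r mulr0 expi0 mulr1.
have {cE}E t : cos (2 * pi * dotc (dsubmx w - dsubmx v) t) = 1.
  have := E t; rewrite cE mul1r.
  move=> /(congr1 (fun z => z * expi (- (2 * pi * dotc (dsubmx v) t)))).
  rewrite -!expiD subrr expi0 dotcDl dotcNl mulrBr.
  by move=> /(congr1 (@complex.Re R)).
rewrite -(vsubmxK w) -(vsubmxK v) uE; congr col_mx; apply/eqP; rewrite -subr_eq0.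
apply: contraT => h0; set h := _ - _ in E h0.
have hh : dotc h h != 0 by apply: contra_neq h0; exact: dotc_eq0.
(* At this point the character of frequency h takes the value expi pi = -1. *)
have := E ((2 * dotc h h)^-1 *: h); rewrite dotcZr.
have -> : 2 * pi * ((2 * dotc h h)^-1 * dotc h h) = pi by field.
by rewrite cospi => /eqP; rewrite -subr_eq0; lra.
Qed.

(** * The doubled phase-space point *)

(** The map (x, xi) |-> (x, x, xi, - xi): shifting f by z amounts to shifting the
    tensor product of f with its conjugate by the image of z. The phase
    x . xi + x . (- xi) of that image vanishes. *)
Definition doubling_mx (R : realType) (d : nat) : 'M[R]_((d + d) + (d + d), d + d) :=
  col_mx (block_mx 1%:M 0 1%:M 0) (block_mx 0 1%:M 0 (- 1%:M)).

Lemma doubling_mxE (R : realType) (d : nat) (z : 'cV[R]_(d + d)) :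
  doubling_mx R d *m z =
  col_mx (col_mx (usubmx z) (usubmx z)) (col_mx (dsubmx z) (- dsubmx z)).
Proof.
rewrite /doubling_mx -{1}(vsubmxK z) mul_col_mx !mul_block_col.
by rewrite !mul1mx !mul0mx mulNmx mul1mx !addr0 !add0r.
Qed.

Lemma tr_doubling_mx (R : realType) (d : nat) :
  (doubling_mx R d)^T =
  row_mx (block_mx 1%:M 1%:M 0 0) (block_mx 0 0 1%:M (- 1%:M)).
Proof.
by rewrite /doubling_mx tr_col_mx !tr_block_mx linearN /= !trmx1 !trmx0.
Qed.

Lemma block44_doubling (R : realType) (d : nat)
   (A11 A12 A13 A14 A21 A22 A23 A24
    A31 A32 A33 A34 A41 A42 A43 A44 : 'M[R]_d) :
  block44 A11 A12 A13 A14 A21 A22 A23 A24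
          A31 A32 A33 A34 A41 A42 A43 A44 *m doubling_mx R d =
  col_mx (block_mx (A11 + A12) (A13 - A14) (A21 + A22) (A23 - A24))
         (block_mx (A31 + A32) (A33 - A34) (A41 + A42) (A43 - A44)).
Proof.
rewrite /block44 /doubling_mx mul_block_col !mulmx_block !add_block_mx.
by rewrite !mulmx0 !mulmx1 !mulmxN !mulmx1 !addr0 !add0r.
Qed.

Lemma tensor_conj_tfshift (R : realType) (d : nat) (z : 'cV[R]_(d + d)) (f g : cfun R d) :
  tensor_conj (tfshift z f) (tfshift z g) =
  tfshift (doubling_mx R d *m z) (tensor_conj f g).
Proof.
apply/funext => t; rewrite doubling_mxE /tfshift /modulate /translate /tensor_conj.
rewrite col_mxKd col_mxKu conjcM -expiN mulrACA -expiD -{5}(vsubmxK t).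
rewrite dotc_col_mx dotcNl mulrBr; congr (_ * (f _ * conjc (g _))).
  by rewrite -{2}(vsubmxK t) opp_col_mx add_col_mx col_mxKu.
by rewrite -{2}(vsubmxK t) opp_col_mx add_col_mx col_mxKd.
Qed.

Lemma tfshift_translate (R : realType) (n : nat) (z : 'cV[R]_n) (G : cfun R n) :
  tfshift (col_mx z 0) G = translate z G.
Proof.
apply/funext => t; rewrite /tfshift /modulate col_mxKd col_mxKu.
by rewrite dotc0l mulr0 expi0 mul1r.
Qed.

Lemma metaplectic_phase_doubling (R : realType) (d : nat)
    (A : 'M[R]_((d + d) + (d + d))) (z : 'cV[R]_(d + d)) :
  A *m (doubling_mx R d *m z) = col_mx z 0 ->
  metaplectic_phase A (doubling_mx R d *m z) = 1.
Proof.
move=> Az; rewrite /metaplectic_phase Az doubling_mxE !col_mxKu !col_mxKd.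
by rewrite dotc0r dotc_col_mx dotcNr !subrr mulr0 expi0.
Qed.

Lemma tensor_conj_gauss (R : realType) (d : nat) :
  tensor_conj (fun t : 'cV[R]_d => (gauss t)%:C)
              (fun t : 'cV[R]_d => (gauss t)%:C) =
  fun t : 'cV[R]_(d + d) => (gauss t)%:C.
Proof.
apply/funext => t; rewrite /tensor_conj conjc_real -rmorphM /=; congr (_%:C).
by rewrite -expRD -opprD -dotc_col_mx vsubmxK.
Qed.

(** * Symplectic matrices that send doubled points to translations *)

(** Write K for the doubling matrix, A for the block matrix and L for the column
    (1, 0). If A K = L, then transposing gives L^T J A = K^T A^T J A = K^T J, and
    the left-hand side is the lower half of A: symplecticity determines it. *)
Lemma Sp_doubling_lower (R : realType) (d : nat) (P Q S T : 'M[R]_(d + d)) :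
  Sp (block_mx P Q S T) ->
  block_mx P Q S T *m doubling_mx R d = col_mx 1%:M 0 ->
  row_mx S T = row_mx (block_mx 0 0 (- 1%:M) 1%:M) (block_mx 1%:M 1%:M 0 0).
Proof.
move=> [_ sympA] AK.
have : (block_mx P Q S T *m doubling_mx R d)^T *m symplectic_J R (d + d)
         *m block_mx P Q S T = (doubling_mx R d)^T *m symplectic_J R (d + d).
  by rewrite trmx_mul -!mulmxA [_^T *m (symplectic_J _ _ *m _)]mulmxA sympA.
rewrite AK tr_doubling_mx tr_col_mx trmx1 trmx0 /symplectic_J.
rewrite mul_row_block mul_row_block mul_row_block.
rewrite !mul1mx !mul0mx !mulmx0 !mulmx1 !mulmxN !mulmx1 !addr0 !add0r.
rewrite ?oppr0 ?mul0mx?mul1mx ?add0r. 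
by rewrite opp_block_mx opprK !oppr0.
Qed.

Lemma Sp_upper_right (R : realType) (n : nat) (P Q S T : 'M[R]_n) :
  Sp (block_mx P Q S T) -> P^T *m T - S^T *m Q = 1%:M.
Proof.
move=> [_]; rewrite /symplectic_J tr_block_mx !mulmx_block => /eq_block_mx[_ + _ _].
by rewrite !mulmx0 !mulmx1 !mulmxN !mulmx1 !addr0 !add0r mulNmx addrC.
Qed.

(** The matrix identity A K = (1, 0) fixes the sums or differences of the two columns
    in each pair of block columns, which gives every entry of the form except the
    shape of the blocks A23 and A24. Once the lower half of A is known, the
    upper right block of A^T J A = J reads A24 = - A11^T. *)
Lemma Sp_doublingP (R : realType) (d : nat)
   (A11 A12 A13 A14 A21 A22 A23 A24
    A31 A32 A33 A34 A41 A42 A43 A44 : 'M[R]_d) :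
  let A := block44 A11 A12 A13 A14 A21 A22 A23 A24
                   A31 A32 A33 A34 A41 A42 A43 A44 in
  Sp A ->
  A *m doubling_mx R d = col_mx 1%:M 0 <->
  A = block44 A11 (1%:M - A11) A13               A13
              A21 (- A21)      (1%:M - A11^T)    (- A11^T)
              A31 (- A31)      A33               A33
              A41 (- A41)      A43               A43.
Proof.
move=> A SpA; split=> [AK|->]; last first.
  rewrite block44_doubling scalar_mx_block -block_mx0.
  rewrite !subrr opprK ![A11 + _]addrC !subrK.
  by congr (col_mx (block_mx _ _ _ _) _).
move: (Sp_upper_right SpA); rewrite !tr_block_mx !mulmx_block scalar_mx_block.
rewrite opp_block_mx add_block_mx => /eq_block_mx[_ + _ _].
have /eq_row_mx[/eq_block_mx[e31 _ e41 _] /eq_block_mx[_ e34 _ e44]] :=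
  Sp_doubling_lower SpA AK.
rewrite e31 e41 e34 e44 trmx0 linearN /= trmx1 mulmx1 mulmx0 mul0mx mulNmx mul1mx.
rewrite addr0 add0r opprK addrC => /eqP; rewrite addr_eq0 => /eqP e24.
move: AK; rewrite /A block44_doubling scalar_mx_block -block_mx0.
move=> /eq_col_mx[/eq_block_mx[e1 e2 e3 e4] /eq_block_mx[f1 f2 f3 f4]].
have -> : A12 = 1%:M - A11 by rewrite -e1 addrC addKr.
have -> : A14 = A13 by apply/esym/eqP; rewrite -subr_eq0 e2.
have -> : A22 = - A21 by apply/eqP; rewrite -addr_eq0 addrC e3.
have -> : A23 = 1%:M - A11^T by rewrite -e4 e24 opprK addrK.
have -> : A32 = - A31 by apply/eqP; rewrite -addr_eq0 addrC f1.
have -> : A34 = A33 by apply/esym/eqP; rewrite -subr_eq0 f2.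
have -> : A42 = - A41 by apply/eqP; rewrite -addr_eq0 addrC f3.
have -> : A44 = A43 by apply/esym/eqP; rewrite -subr_eq0 f4.
by rewrite e24 e31 e41.
Qed.

(** * Covariance of the Wigner representation *)

(** A unitary operator is injective on rays: the difference F - c G is sent to 0 and
    hence has norm 0. *)
Lemma unitary_L2_phase (R : realType) (n : nat) (U : cfun R n -> cfun R n)
    (F G : cfun R n) (c : R[i]) :
  unitary_L2 U -> L2 F -> L2 G -> L2 (fun t => F t - c * G t) ->
  eq_ae (U F) (fun t => c * U G t) -> eq_ae (fun t => F t - c * G t) (fun=> 0).
Proof.
move=> [L2U _ linU innerU _] LF LG LD UFG.
apply: L2_inner_self_eq0 => //; rewrite -innerU//.
have U0 : eq_ae (U (fun t => F t - c * G t)) (fun=> 0).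
  have := linU (- c) G F LG LF.
  rewrite (_ : (fun t => - c * G t + F t) = (fun t => F t - c * G t)); last first.
    by apply/funext => t; rewrite mulNr addrC.
  by apply: filterS2 UFG => t -> ->; rewrite mulNr addrC subrr.
set V := U _ in U0 *.
have [mR mI _] : L2 V by exact: L2U.
have [pR pI] := cmeasurableM (conj mR mI) (cmeasurableJ (conj mR mI)).
have R0 (f : R[i] -> R) : f 0 = 0 ->
    measurable_fun setT (fun t => f (V t * conjc (V t))) ->
    \int[lebesgue_cV R n]_t f (V t * conjc (V t)) = 0.
  move=> f0 mf; rewrite /Rintegral (ae_eq_integral (cst 0%E))//=.
  - by rewrite integral0.
  - exact/measurable_EFinP.
  - by apply: filterS U0 => t -> _; rewrite mul0r f0.
by rewrite /L2_inner !R0.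
Qed.

Lemma mulmx_cV_inj (R : realType) (m n : nat) (M N : 'M[R]_(m, n)) :
  (forall z : 'cV[R]_n, M *m z = N *m z) -> M = N.
Proof.
move=> MN; apply/matrixP => i j; have /matrixP/(_ i 0) := MN (delta_mx j 0).
by rewrite -!colE !mxE.
Qed.

(** Covariance is an identity between two operators applied to the tensor products
    of f with its conjugate, so it is read off from the shifts involved: A sends
    every doubled point to the phase-space point of the corresponding translation. *)
Lemma covariant_doublingP (R : realType) (d : nat) (A : 'M[R]_((d + d) + (d + d)))
    (muA : cfun R (d + d) -> cfun R (d + d)) :
  A \in unitmx -> metaplectic A muA ->
  covariant muA <-> A *m doubling_mx R d = col_mx 1%:M 0.
Proof.
move=> uA [UmuA intertw]; set K := doubling_mx R d; split=> [cov|AK]; last first.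
  move=> f z /schwartz_decaying df.
  have AKz : A *m (K *m z) = col_mx z 0.
    by rewrite mulmxA AK mul_col_mx mul1mx mul0mx.
  have := intertw (K *m z) _ (decaying_L2 (decaying_tensor_conj df df)).
  rewrite AKz tfshift_translate metaplectic_phase_doubling// -tensor_conj_tfshift.
  by apply: filterS => t; rewrite mul1r => /esym.
apply: mulmx_cV_inj => z; rewrite -mulmxA [RHS]mul_col_mx mul1mx mul0mx.
(* Conjugating the translation by z with muA gives the shift by v, while
   covariance gives the shift by K z; the Gaussian tells shifts apart. *)
pose g (n : nat) : cfun R n := fun t => (gauss t)%:C.
have gK : tensor_conj (g d) (g d) = g (d + d)%N by exact: tensor_conj_gauss.
have dg : decaying (g (d + d)%N).
  rewrite -gK; have dgd := schwartz_decaying (schwartz_gauss R d).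
  exact: decaying_tensor_conj.
pose v := invmx A *m col_mx z 0.
have Av : A *m v = col_mx z 0 by rewrite mulmxA mulmxV// mul1mx.
suff <- : v = K *m z by [].
apply/esym; apply: (@tfshift_gauss_inj _ _ _ _ (metaplectic_phase A v)).
  exact: sqnormc_expi.
have dv := decaying_tfshift v dg; have dw := decaying_tfshift (K *m z) dg.
have dcv : decaying
    (fun t => metaplectic_phase A v * tfshift v (g (d + d)%N) t).
  by apply: (@decayingM _ _ _ _ 1) => // t; rewrite sqnormc_expi.
apply/funeqP; apply: eq_ae_ccontinuous.
- exact: ccontinuous_tfshift_gauss.
- apply: ccontinuousM; first exact: ccontinuous_cst.
  exact: ccontinuous_tfshift_gauss.
apply: (unitary_L2_phase UmuA); try exact: decaying_L2.
  exact/decaying_L2/decayingB.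
have := cov (g d) z (schwartz_gauss R d).
rewrite /Wigner_rep tensor_conj_tfshift gK -tfshift_translate -Av.
have := intertw v _ (decaying_L2 dg).
by apply: filterS2 => t -> ->.
Qed.

Theorem proposition4p4 (R : realType) (d : nat)
    (A : 'M[R]_((d + d) + (d + d)))
    (A11 A12 A13 A14 A21 A22 A23 A24
     A31 A32 A33 A34 A41 A42 A43 A44 : 'M[R]_d)
    (A_Sp : Sp A)
    (A_blocks : A = block44 A11 A12 A13 A14
                            A21 A22 A23 A24
                            A31 A32 A33 A34
                            A41 A42 A43 A44)
    (muA : cfun R (d + d) -> cfun R (d + d))
    (muA_metaplectic : metaplectic A muA) :
  covariant muA <->
  A = block44 A11 (1%:M - A11) A13               A13
              A21 (- A21)      (1%:M - A11^T)    (- A11^T)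
              A31 (- A31)      A33               A33
              A41 (- A41)      A43               A43.
Proof.
apply: iff_trans (covariant_doublingP (proj1 A_Sp) muA_metaplectic) _.
by rewrite A_blocks in A_Sp *; exact: Sp_doublingP.
Qed.
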